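(* Let $n\ge1$ and let $T=(\tau_1,\dots,\tau_n)$ be a list of thresholds with $1\ge\tau_1\ge\dots\ge\tau_n>0$ such that $\mathtt{RBF}(\cdot,T)$ always outputs a $T$-MMS allocation in the oblivious setting for $n$ agents. Then the ex-ante MMS guarantee $\frac1n\sum_{i=1}^n\tau_i$ and the ex-post MMS guarantee $\tau_n$, obtained by running $\mathtt{RBF}$ with thresholds $T$ and cyclically random priority ranks, satisfy $$\frac1n\sum_{i=1}^n\tau_i\le \frac{13}{24}+3\ln\left(\frac{10}{9}\right)+\frac1{3n}\qquad\text{and}\qquad \tau_n\le\frac{3n}{4n-2}=\frac34+\frac3{8n-4}.$$
   Context: Write $[t]=\{1,\dots,t\}$. A fair division instance consists of agents $[n]$, goods $[m]$, and additive valuations $v_i:2^{[m]}\to\mathbb{R}_{\ge0}$. $\mathrm{MMS}_i$ is the maximum, over partitions $(P_1,\dots,P_n)$ of $[m]$, of $\min_j v_i(P_j)$. A valuation $v_i$ is ordered if $v_i(1)\ge\dots\ge v_i(m)$, and $n$-normalized if there is a partition $(P_1,\dots,P_n)$ of $[m]$ with $v_i(P_j)=1$ for all $j$ (so $\mathrm{MMS}_i=1$); an instance is ordered / $n$-normalized if all its valuations are. Agent $i$ has priority rank $i$. A (possibly partial) allocation $A$ is $T$-MMS if $v_i(A_i)\ge\tau_i\mathrm{MMS}_i$ for all $i$. Shifting priority ranks cyclically by a uniformly random amount makes every agent's rank uniform on $[n]$, so an algorithm that guarantees $T$-MMS then guarantees ex-post $\tau_n$-MMS (every realized allocation gives each agent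 at least $\tau_n\mathrm{MMS}_i$) and ex-ante $\left(\frac1n\sum_i\tau_i\right)$-MMS (in expectation). For a finite set $S$ of positive integers, $\#(S,j)$ is the $j$-th smallest element of $S$, and $\#(S,J)=\{\#(S,j): j\in J,\ j\le|S|\}$. Algorithm $\mathtt{RBF}(\mathcal I,T)$. Input: an ordered, $n$-normalized instance with agents $[n]$, goods $[m]$, and thresholds $1\ge\tau_1\ge\dots\ge\tau_n>0$. Phase 1 (reductions). Start with $N=[n]$, $M=[m]$. While $N\ne\emptyset$ and $M\neq\emptyset$: let $S_1=\#(M,\{1\})$, $S_2=\#(M,\{|N|,|N|+1\})$, $S_3=\#(M,\{2|N|-1,2|N|,2|N|+1\})$, $S_4=\#(M,\{1,2|N|+1\})$. Find the lexicographically smallest pair $(k,i)\in[4]\times N$ with $v_i(S_k)\ge\tau_i$. If it exists, give $S_k$ to agent $i$ (a type-$k$ reduction) and replace $N$ by $N\setminus\{i\}$ and $M$ by $M\setminus S_k$; otherwise end phase 1. Phase 2 (bag filling). With the remaining $N$ and $M$, form bags $B_j=\{\#(M,j),\#(M,2|N|+1-j)\}$ for $j=1,\dots,|N|$. While some agent is unsatisfied: if some unsatisfied agent $i$ has $v_i(B_k)\ge\tau_i$ for some unassigned bag $B_k$, take the smallest such $i$, give her such a bag, and mark her satisfied; otherwise, if there are unassigned goods outside the bags, add the one with smallest index (most valuable) to an arbitrary unassigned bag; otherwise, allocate the remaining bags arbitrarily to the unsatisfied agents and stop. Arbitrary choices are resolved by any fixed rule. Oblivious setting. View $\mathtt{RBF}$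 as an interactive protocol that accesses valuations only through value queries ''$v_i(S)=?$'' for the sets $S_1,\dots,S_4$ and the bags that it considers. ''$\mathtt{RBF}(\cdot,T)$ always outputs a $T$-MMS allocation in the oblivious setting'' means: for every $i\in[n]$, every $m$ and every additive, ordered, $n$-normalized valuation $v_i$ on $[m]$, if agent $i$ answers all value queries truthfully according to $v_i$ while all other agents answer value queries by arbitrary nonnegative numbers (possibly chosen adversarially with knowledge of $v_i$, and not required to be consistent with any additive, ordered or normalized valuation), then agent $i$ receives a bundle $A_i$ with $v_i(A_i)\ge\tau_i\mathrm{MMS}_i=\tau_i$. *)

(* Defs.v *)
(* Agents are 'I_n and goods are 'I_m: the
   ordinal of value k stands for agent, resp. good, k + 1. *)
From mathcomp Require Import all_boot all_order all_algebra.
From mathcomp Require Import reals.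

Set Implicit Arguments.
Unset Strict Implicit.
Unset Printing Implicit Defensive.

Import Order.TTheory GRing.Theory Num.Theory.
Local Open Scope ring_scope.

Definition additive_valuation (R : realType) (m : nat)
    (v : {set 'I_m} -> R) : Prop :=
  (forall S, 0 <= v S) /\ (forall S, v S = \sum_(g in S) v [set g]).

(* A partition of the goods into n possibly empty bundles is given by the map
   P that sends each good to the index of its bundle. *)
Definition bundle (n m : nat) (P : {ffun 'I_m -> 'I_n}) (j : 'I_n) :
  {set 'I_m} := [set g | P g == j].

(* The neutral values v [set: _] of the minimum and 0 of the maximum are
   harmless: 0 <= v S <= v [set: _] for an additive valuation, and n > 0. *)
Definition MMS (R : realType) (n m : nat) (v : {set 'I_m} -> R) : R :=
  \big[Num.max/0]_(P : {ffun 'I_m -> 'I_n})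
     \big[Num.min/v [set: 'I_m]]_(j < n) v (bundle P j).

Definition ordered (R : realType) (m : nat) (v : {set 'I_m} -> R) : Prop :=
  forall g h : 'I_m, (g <= h)%N -> v [set h] <= v [set g].

Definition normalized (R : realType) (n m : nat) (v : {set 'I_m} -> R) : Prop :=
  exists P : {ffun 'I_m -> 'I_n}, forall j : 'I_n, v (bundle P j) = 1.

(* #(S, J): g in S is the j-th smallest element of S, counting from 1, iff
   j elements of S are at most g. *)
Definition ranked (m : nat) (S : {set 'I_m}) (J : seq nat) : {set 'I_m} :=
  [set g in S | #|[set h in S | (h <= g)%N]| \in J].

Variant phase : Type := Reduction | BagFilling | Halted.

Definition is_halted (p : phase) : bool :=
  if p is Halted then true else false.

Record state (R : realType) (n m : nat) : Type := State {
  stage : phase;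
  (* unsatisfied agents: N *)
  agents : {set 'I_n};
  (* unallocated goods outside the bags: M *)
  goods : {set 'I_m};
  (* B_(k + 1) is [bags st k]; meaningful for k in [unassigned st] only *)
  bags : {ffun 'I_n -> {set 'I_m}};
  unassigned : {set 'I_n};
  alloc : {ffun 'I_n -> {set 'I_m}};
  (* all past value queries (agent, set), with their answers *)
  transcript : seq ('I_n * {set 'I_m} * R) }.

(* A way of answering value queries: [ans st i S] is the answer of agent i to
   the query v_i(S) made in state st.  The state contains the transcript and
   never recurs during a run, so answers may be adaptive, and an agent may
   give different answers to the same query made at different times. *)
Definition answers (R : realType) (n m : nat) : Type :=
  state R n m -> 'I_n -> {set 'I_m} -> R.

(* A rule resolving arbitrary choices: [rule m st K] is the bag chosen in
   state st among those with indices in K.  Every arbitrary choice of RBF is a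
   choice of an unassigned bag. *)
Definition tie_rule (R : realType) (n : nat) : Type :=
  forall m : nat, state R n m -> {set 'I_n} -> 'I_n.

Definition proper_rule (R : realType) (n : nat) (rule : tie_rule R n) : Prop :=
  forall (m : nat) (st : state R n m) (K : {set 'I_n}),
    K != set0 -> rule m st K \in K.

Definition init (R : realType) (n m : nat) : state R n m :=
  State Reduction [set: 'I_n] [set: 'I_m] [ffun=> set0] set0 [ffun=> set0] [::].

Definition ask (R : realType) (n m : nat) (ans : answers R n m)
    (Q : seq ('I_n * {set 'I_m})) (st : state R n m) : state R n m :=
  State (stage st) (agents st) (goods st) (bags st) (unassigned st) (alloc st)
    (transcript st ++ [seq (q, ans st q.1 q.2) | q <- Q]).

Definition reduction_sets (n m : nat) (N : {set 'I_n}) (M : {set 'I_m}) :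
    seq {set 'I_m} :=
  [:: ranked M [:: 1];
      ranked M [:: #|N|; #|N| + 1];
      ranked M [:: 2 * #|N| - 1; 2 * #|N|; 2 * #|N| + 1];
      ranked M [:: 1; 2 * #|N| + 1]]%N.

Definition reduce (R : realType) (n m : nat) (i : 'I_n) (S : {set 'I_m})
    (st : state R n m) : state R n m :=
  State Reduction (agents st :\ i) (goods st :\: S) (bags st) (unassigned st)
    [ffun j => if j == i then S else alloc st j] (transcript st).

Definition form_bags (R : realType) (n m : nat) (st : state R n m) :
    state R n m :=
  let N := agents st in
  let M := goods st in
  let B := [ffun k : 'I_n => ranked M [:: k.+1; 2 * #|N| + 1 - k.+1]%N] in
  let K := [set k : 'I_n | (k < #|N|)%N] in
  State BagFilling N (M :\: \bigcup_(k in K) B k) B K (alloc st)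
    (transcript st).

Definition assign (R : realType) (n m : nat) (i k : 'I_n)
    (st : state R n m) : state R n m :=
  State (stage st) (agents st :\ i) (goods st) (bags st) (unassigned st :\ k)
    [ffun j => if j == i then bags st k else alloc st j] (transcript st).

Definition fill (R : realType) (n m : nat) (k : 'I_n) (g : 'I_m)
    (st : state R n m) : state R n m :=
  State (stage st) (agents st) (goods st :\ g)
    [ffun l => if l == k then g |: bags st k else bags st l] (unassigned st)
    (alloc st) (transcript st).

Definition halt (R : realType) (n m : nat) (st : state R n m) : state R n m :=
  State Halted (agents st) (goods st) (bags st) (unassigned st) (alloc st)
    (transcript st).

(* One iteration of the loop of the current phase.  [enum] lists sets of
   ordinals in increasing order, so that the queries of the reduction phase
   are listed in the lexicographic order of the pairs (k, i). *)
Definition step (R : realType) (n m : nat) (T : 'I_n -> R)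
    (rule : tie_rule R n) (ans : answers R n m) (st : state R n m) :
    state R n m :=
  let N := agents st in
  let M := goods st in
  let K := unassigned st in
  match stage st with
  | Reduction =>
      if (N == set0) || (M == set0) then form_bags st else
      let Q := [seq (i, X) | X <- reduction_sets N M, i <- enum N] in
      let st' := ask ans Q st in
      if ohead [seq q <- Q | T q.1 <= ans st q.1 q.2] is Some q
      then reduce q.1 q.2 st'
      else form_bags st'
  | BagFilling =>
      if N == set0 then halt st else
      let Q := [seq (i, bags st k) | i <- enum N, k <- enum K] in
      let st' := ask ans Q st in
      let good_bags i := [set k in K | T i <= ans st i (bags st k)] in
      if ohead [seq i <- enum N | good_bags i != set0] is Some i
      then assign i (rule m st' (good_bags i)) st'
      else if ohead (enum M) is Some g
      then fill (rule m st' K) g st'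
      else halt (foldl (fun s i => assign i (rule m s (unassigned s)) s)
                       st' (enum N))
  | Halted => st
  end.

(* The number of iterations is large enough, see [RBF_halted]. *)
Definition RBF_final (R : realType) (n m : nat) (T : 'I_n -> R)
    (rule : tie_rule R n) (ans : answers R n m) : state R n m :=
  iter (n + m + 2) (step T rule ans) (init R n m).

Definition RBF (R : realType) (n m : nat) (T : 'I_n -> R)
    (rule : tie_rule R n) (ans : answers R n m) : {ffun 'I_n -> {set 'I_m}} :=
  alloc (RBF_final T rule ans).

Definition oblivious_T_MMS (R : realType) (n : nat) (T : 'I_n -> R)
    (rule : tie_rule R n) : Prop :=
  forall (i : 'I_n) (m : nat) (v : {set 'I_m} -> R) (ans : answers R n m),
    additive_valuation v -> ordered v -> normalized n v ->
    (forall st j S, 0 <= ans st j S) ->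
    (forall st S, ans st i S = v S) ->
    T i * MMS n v <= v (RBF T rule ans i).

Definition last_agent (n : nat) (n_gt0 : (0 < n)%N) : 'I_n :=
  Ordinal (etrans (ltn_predL n) n_gt0).

Definition steps_left (R : realType) (n m : nat) (st : state R n m) : nat :=
  match stage st with
  | Reduction => #|agents st| + #|goods st| + 2
  | BagFilling => #|agents st| + #|goods st| + 1
  | Halted => 0
  end.

Lemma steps_left_step (R : realType) (n m : nat) (T : 'I_n -> R)
    (rule : tie_rule R n) (ans : answers R n m) (st : state R n m) :
  ~~ is_halted (stage st) ->
  (steps_left (step T rule ans st) < steps_left st)%N.
Proof.
have ohead_mem (X : eqType) (s : seq X) x : ohead s = Some x -> x \in s.
  by case: s => //= y s [->]; rewrite mem_head.
have cardD (X : finType) (A : {set X}) x : x \in A -> #|A :\ x|.+1 = #|A|.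
  by move=> xA; rewrite (cardsD1 x A) xA.
have form s : (#|agents s| = #|agents st|)%N -> goods s = goods st ->
    (steps_left (form_bags s) < #|agents st| + #|goods st| + 2)%N.
  move=> eA eM; rewrite /steps_left /= eA eM addn1 addn2 !ltnS leq_add2l.
  exact/subset_leq_card/subsetDl.
rewrite /step {2}/steps_left; cbv zeta.
move: (reduction_sets (agents st) (goods st)) => sets; case stageE: (stage st) => //= _.
- case: ifP => _; first exact: form.
  case eqh: (ohead _) => [[i X]|]; last exact: form.
  move: (ohead_mem _ _ _ eqh); rewrite mem_filter => /andP[_].
  case/allpairsPdep => X' [i' [_]]; rewrite mem_enum => iN [-> _].
  rewrite /steps_left /= -(cardD _ _ _ iN) !addSn ltnS leq_add2r leq_add2l.
  exact/subset_leq_card/subsetDl.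
- case: ifP => _; first by rewrite /steps_left /= addn1.
  case eqh: (ohead _) => [i|].
    move: (ohead_mem _ _ _ eqh); rewrite mem_filter mem_enum => /andP[_ iN].
    by rewrite /steps_left /= stageE -(cardD _ _ _ iN) !addSn.
  case eqg: (ohead _) => [g|]; last by rewrite /steps_left /= addn1.
  move: (ohead_mem _ _ _ eqg); rewrite mem_enum => gM.
  by rewrite /steps_left /= stageE -(cardD _ _ _ gM) !addn1 addnS.
Qed.

Lemma RBF_halted (R : realType) (n m : nat) (T : 'I_n -> R)
    (rule : tie_rule R n) (ans : answers R n m) :
  is_halted (stage (RBF_final T rule ans)).
Proof.
have haltedP (st : state R n m) : is_halted (stage st) = (steps_left st == 0)%N.
  by rewrite /steps_left; case: (stage st); rewrite ?addn1 ?addn2.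
have iterP k : (steps_left (iter k (step T rule ans) (init R n m)) <=
    n + m + 2 - k)%N.
  elim: k => [|k IH]; first by rewrite /steps_left /= !cardsT !card_ord subn0.
  rewrite iterS; set st := iter _ _ _ in IH *.
  have [st0|st0] := boolP (is_halted (stage st)).
    rewrite /step; case: (stage st) (haltedP st) st0 => //= + _.
    by move=> /esym/eqP ->.
  rewrite subnS -ltnS (leq_trans (steps_left_step T rule ans st0)) //.
  rewrite (leq_trans IH) //; exact: leqSpred.
by rewrite haltedP -leqn0 (leq_trans (iterP _)) // subnn.
Qed.

(* Main.v *)
(* Let agent i be truthful, so that i agents have a higher priority.  If she
   values S_1, ..., S_4 below her threshold at the start and the other agents
   refuse these sets, then all n agents reach the bag filling phase.  There, the
   agents of higher priority may take every bag that would satisfy agent i, and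
   those of lower priority every bag that is about to satisfy her.  Two
   instances let the others consume so much that she fails unless
     tau_i <= 3n / (3n + i - 1)   or, when 2i <= n,   tau_i <= 1 - i / (3n).
   The sum of the thresholds is bounded by the second estimate for i <= n / 2,
   by monotonicity up to about 3n / 5, and from there on by the first one,
   whose sum is the logarithm. *)
Require Import Defs.
From mathcomp Require Import all_boot all_order all_algebra.
From mathcomp Require Import reals exp.
From mathcomp Require Import zify ring lra.

Set Implicit Arguments.
Unset Strict Implicit.
Unset Printing Implicit Defensive.

Import Order.TTheory GRing.Theory Num.Theory.
Local Open Scope ring_scope.

(** * Runs of [RBF] in which one agent is truthful and the others follow a script *)

Lemma ohead_enum_min (n : nat) (N : {set 'I_n}) (p : pred 'I_n) (j j' : 'I_n) :
  ohead [seq i <- enum N | p i] = Some j -> j' \in N -> p j' -> (j <= j')%N.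
Proof.
move=> jE j'N pj'.
have leT : transitive leq by move=> x y z; exact: leq_trans.
have: sorted leq (map val [seq i <- enum N | p i]).
  rewrite sorted_map; apply: sorted_filter; first by move=> x y z; exact: leT.
  rewrite {1}/(enum _) /enum_mem; apply: sorted_filter; first by move=> x y z; exact: leT.
  have: sorted leq (map val (enum 'I_n)) by rewrite val_enum_ord iota_sorted.
  by rewrite sorted_map enumT.
have: j' \in [seq i <- enum N | p i] by rewrite mem_filter pj' mem_enum.
case: [seq i <- enum N | p i] jE => //= a s [->]; rewrite inE => /orP[/eqP->//|j's].
rewrite /= path_sortedE //.
by case/andP=> /allP/(_ _ (map_f val j's)).
Qed.

(** The thresholds lie in [(0, 1]], so the answers 1 and 0 of another agent mean acceptance and
    refusal whatever her threshold is. All reductions are refused, and bags are judged by their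
    value to agent [i], which the adversary knows. *)
Definition stubborn_answers (R : realType) (n m : nat) (i : 'I_n)
    (v : {set 'I_m} -> R) (accept : 'I_n -> R -> bool) : answers R n m :=
  fun st j S => if j == i then v S
    else if stage st is BagFilling then (accept j (v S))%:R else 0.

Lemma stubborn_answersE (R : realType) (n m : nat) (T : 'I_n -> R) (i j : 'I_n)
    (v : {set 'I_m} -> R) (accept : 'I_n -> R -> bool) (st : state R n m) S :
  T j <= 1 -> 0 < T j -> j != i ->
  (T j <= stubborn_answers i v accept st j S) =
  (if stage st is BagFilling then accept j (v S) else false).
Proof.
move=> T1 T0 /negPf ji; rewrite /stubborn_answers ji.
by case: (stage st); rewrite ?leNgt ?T0 //; case: (accept _ _); rewrite /= -leNgt ?T1 // leNgt T0.
Qed.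

(** No agent accepts a reduction at the start, so the bags are formed with all agents and all goods
    present. The transcript is left open because the scripted answers do not depend on it. *)
Lemma step_init (R : realType) (n m : nat) (T : 'I_n -> R) (rule : tie_rule R n)
    (i : 'I_n) (v : {set 'I_m} -> R) (accept : 'I_n -> R -> bool) :
  (forall j, T j <= 1) -> (forall j, 0 < T j) ->
  (forall X, X \in reduction_sets [set: 'I_n] [set: 'I_m] -> v X < T i) ->
  exists tr, step T rule (stubborn_answers i v accept) (init R n m) =
    form_bags (State Reduction [set: 'I_n] [set: 'I_m] [ffun=> set0] set0
      [ffun=> set0] tr).
Proof.
move=> T1 T0 vX; rewrite /step [stage _]/= [agents _]/= [goods _]/=.
case: ifP => _; first by exists [::].
case E: (ohead _) => [q|]; last by eexists.
exfalso; have: q \in [seq q <- [seq (j, X) | X <- reduction_sets [set: 'I_n] [set: 'I_m],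
    j <- enum [set: 'I_n]] | T q.1 <= stubborn_answers i v accept (init R n m) q.1 q.2].
  by case: (filter _ _) E => //= a l [->]; rewrite mem_head.
rewrite mem_filter => /andP[+ /allpairsPdep[X [j [XS _ qE]]]]; rewrite qE /=.
have [->|ji] := eqVneq j i; last by rewrite stubborn_answersE.
by rewrite /stubborn_answers eqxx leNgt vX.
Qed.

(** This treats the closing distribution: a property shared by all unassigned bags passes to the
    bundle of every agent served there, however the choices are resolved. *)
Lemma alloc_assign_all (R : realType) (n m : nat) (rule : tie_rule R n)
    (i : 'I_n) (a : pred {set 'I_m}) (l : seq 'I_n) (st : state R n m) :
  proper_rule rule -> (size l <= #|unassigned st|)%N ->
  (forall k, k \in unassigned st -> a (bags st k)) ->
  i \in l \/ a (alloc st i) ->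
  a (alloc (foldl (fun s j => assign j (rule m s (unassigned s)) s) st l) i).
Proof.
move=> rP; elim: l st => [|j l IH] st /= sl ak; first by case.
have K0 : unassigned st != set0 by rewrite -card_gt0 (leq_trans _ sl).
have kK := rP m st _ K0; set k := rule _ _ _ in kK *.
move=> il; apply: IH => /=.
- by rewrite (cardsD1 k) kK ltnS in sl.
- by move=> k'; rewrite !inE => /andP[_]; exact: ak.
- rewrite ffunE; have [->|ij] := eqVneq i j; first by right; exact: ak.
  by case: il => [|]; [rewrite inE (negPf ij); left | right].
Qed.

(** If every bag that reaches the threshold of agent [i] is also acceptable to a remaining agent of
    higher priority, then the smallest index wins and agent [i] never gets to choose. She is served
    only in the closing distribution, when all unassigned bags are below her threshold. The
    invariant [inv] is left free, to record why such an agent is always there. *)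
Lemma RBF_safe (R : realType) (n m : nat) (T : 'I_n -> R) (rule : tie_rule R n)
    (i : 'I_n) (v : {set 'I_m} -> R) (accept : 'I_n -> R -> bool)
    (inv : {set 'I_n} -> {set 'I_m} -> {ffun 'I_n -> {set 'I_m}} ->
           {set 'I_n} -> Prop) :
  proper_rule rule -> (forall j, T j <= 1) -> (forall j, 0 < T j) ->
  (forall X, X \in reduction_sets [set: 'I_n] [set: 'I_m] -> v X < T i) ->
  let B0 := [ffun k : 'I_n => ranked [set: 'I_m] [:: k.+1; 2 * n + 1 - k.+1]%N] in
  inv [set: 'I_n] (~: \bigcup_k B0 k) B0 [set: 'I_n] ->
  (forall N M B K k, inv N M B K -> k \in K -> T i <= v (B k) ->
    exists j, [/\ j \in N, (j < i)%N & accept j (v (B k))]) ->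
  (forall N M B K j k, inv N M B K -> j \in N -> j != i -> k \in K ->
    accept j (v (B k)) -> inv (N :\ j) M B (K :\ k)) ->
  (forall (N : {set 'I_n}) M B K g k, inv N M B K -> i \in N -> #|K| = #|N| ->
    (forall l, l \in K -> v (B l) < T i) ->
    (forall j l, j \in N -> j != i -> l \in K -> ~~ accept j (v (B l))) ->
    g \in M -> k \in K ->
    inv N (M :\ g) [ffun l => if l == k then g |: B k else B l] K) ->
  v (RBF T rule (stubborn_answers i v accept) i) < T i.
Proof.
move=> rP T1 T0 vX B0 inv0 inv_hi inv_assign inv_fill.
set ans := stubborn_answers i v accept.
(* The reduction phase is over after one step, hence [False]; in a halted state [good] is the
   conclusion itself. *)
pose good (st : state R n m) := match stage st with
  | Reduction => False
  | BagFilling => [/\ i \in agents st, #|unassigned st| = #|agents st| &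
      inv (agents st) (goods st) (bags st) (unassigned st)]
  | Halted => v (alloc st i) < T i
  end.
have good1 : good (step T rule ans (init R n m)).
  have [tr ->] := step_init rule accept T1 T0 vX; rewrite /good /=.
  have -> : [set k : 'I_n | (k < #|[set: 'I_n]|)%N] = [set: 'I_n].
    by apply/setP => k; rewrite !inE cardsT card_ord ltn_ord.
  split; rewrite ?inE //; move: inv0; rewrite /B0 !cardsT !card_ord -setTD.
  by under [X in _ :\: X]eq_bigl => k do rewrite -[true](in_setT k).
have goodS st : good st -> good (step T rule ans st).
  rewrite {1}/good /step; case Est: (stage st) => //=; last by rewrite /good Est.
  case=> iN cK I; case: ifP => [/eqP N0|_]; first by rewrite N0 inE in iN.
  set st' := ask _ _ _; pose K := unassigned st.
  have ansE j k : j != i -> (T j <= ans st j (bags st k)) = accept j (v (bags st k)).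
    by move=> ji; rewrite stubborn_answersE // Est.
  have ansi k : ans st i (bags st k) = v (bags st k).
    by rewrite /ans /stubborn_answers eqxx.
  case Ej: (ohead _) => [j|].
    have: j \in [seq i0 <- enum (agents st) |
        [set k in unassigned st | T i0 <= ans st i0 (bags st k)] != set0].
      by case: (filter _ _) Ej => //= a l [->]; rewrite mem_head.
    rewrite mem_filter mem_enum => /andP[gj jN].
    have := rP m st' _ gj; set k := rule _ _ _; rewrite inE => /andP[kK vk].
    have ji : j != i.
      (* Were agent [i] served, [inv_hi] would give an agent of smaller index who accepts the same
         bag, against the minimality of the agent served. *)
      apply: contraTneq (vk) => ji; rewrite ji ansi; apply/negP => vk'.
      have [j' [j'N j'i aj']] := inv_hi _ _ _ _ _ I kK vk'.
      suff: (j <= j')%N by rewrite ji leqNgt j'i.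
      apply: (ohead_enum_min Ej j'N); apply/set0Pn; exists k.
      by rewrite inE kK ansE // neq_ltn j'i.
    rewrite ansE // in vk; rewrite /good /= Est; split.
    + by rewrite !inE eq_sym ji.
    + have := cardsD1 k (unassigned st); have := cardsD1 j (agents st).
      by rewrite kK jN cK => -> /eqP; rewrite eqSS => /eqP.
    + exact: inv_assign.
  have none j k : j \in agents st -> k \in unassigned st ->
      ~~ (T j <= ans st j (bags st k)).
    move=> jN kK; apply/negP => vk.
    have: j \in [seq i0 <- enum (agents st) |
        [set k in unassigned st | T i0 <= ans st i0 (bags st k)] != set0].
      rewrite mem_filter mem_enum jN andbT; apply/set0Pn; exists k.
      by rewrite inE kK.
    by case: (filter _ _) Ej.
  have lti l : l \in unassigned st -> v (bags st l) < T i.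
    by move=> lK; rewrite ltNge -ansi none.
  have K0 : unassigned st != set0 by rewrite -card_gt0 cK card_gt0; apply/set0Pn; exists i.
  case Eg: (ohead _) => [g|].
    have gM : g \in goods st.
      by rewrite -mem_enum; case: (enum _) Eg => //= a l [->]; rewrite mem_head.
    rewrite /good /= Est; split => //; apply: inv_fill => //; last exact: rP.
    by move=> j l jN ji lK; rewrite -ansE // none.
  rewrite /good /=; apply: (@alloc_assign_all _ _ _ _ _ (fun S => v S < T i)) => //=.
    by rewrite cK cardE.
  by left; rewrite mem_enum.
have goodn k : good (iter k.+1 (step T rule ans) (init R n m)).
  by elim: k => // k; exact: goodS.
have := RBF_halted T rule ans; rewrite /RBF /RBF_final addn2.
by move: (goodn (n + m).+1); rewrite {1}/good; case: (stage _).
Qed.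

(** * Valuations given by natural weights over a common denominator *)

Definition weight_val (R : realType) (m U : nat) (wt : nat -> nat)
    (S : {set 'I_m}) : R := (\sum_(g in S) wt g)%:R / U%:R.

Lemma weight_val_ge0 (R : realType) (m U : nat) (wt : nat -> nat) (S : {set 'I_m}) :
  0 <= weight_val R U wt S.
Proof. by rewrite divr_ge0 ?ler0n. Qed.

Lemma weight_val1 (R : realType) (m U : nat) (wt : nat -> nat) (g : 'I_m) :
  weight_val R U wt [set g] = (wt g)%:R / U%:R.
Proof. by rewrite /weight_val big_set1. Qed.

Lemma weight_val_additive (R : realType) (m U : nat) (wt : nat -> nat) :
  additive_valuation (@weight_val R m U wt).
Proof.
split=> S; first exact: weight_val_ge0.
rewrite {1}/weight_val natr_sum mulr_suml.
by apply: eq_bigr => g _; rewrite weight_val1.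
Qed.

Lemma weight_valD1 (R : realType) (m U : nat) (wt : nat -> nat) (S : {set 'I_m}) g :
  g \in S -> weight_val R U wt S = (wt g)%:R / U%:R + weight_val R U wt (S :\ g).
Proof.
move=> gS; rewrite /weight_val (big_setD1 g) //= natrD mulrDl //.
Qed.

Lemma weight_valU1_le (R : realType) (m U : nat) (wt : nat -> nat) (S : {set 'I_m}) g :
  weight_val R U wt (g |: S) <= (wt g)%:R / U%:R + weight_val R U wt S.
Proof.
have [gS|gS] := boolP (g \in S); last by rewrite /weight_val big_setU1 //= natrD mulrDl.
rewrite (_ : g |: S = S); first by rewrite lerDr divr_ge0 ?ler0n.
by apply/setUidPr; rewrite sub1set.
Qed.

(** The normalizing partition competes in the maximum. The neutral value of its minimum is at least
    1 too, since the set of all goods contains one of the parts. *)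
Lemma MMS_ge1 (R : realType) (n m : nat) (v : {set 'I_m} -> R) :
  (0 < n)%N -> additive_valuation v -> normalized n v -> 1 <= MMS n v.
Proof.
move=> n0 [v0 vadd] [P vP].
apply: (@le_trans _ _ (\big[Num.min/v [set: 'I_m]]_(j < n) v (bundle P j))).
  apply: (@big_ind _ (fun x => 1 <= x)).
  - rewrite -(vP (Ordinal n0)) vadd [leRHS]vadd.
    rewrite [leRHS](bigID (mem (bundle P (Ordinal n0)))) /=.
    under [X in _ <= X + _]eq_bigl => g do rewrite inE.
    by rewrite lerDl sumr_ge0.
  - by move=> x y x1 y1; rewrite le_min x1.
  - by move=> j _; rewrite vP.
by rewrite /MMS; apply: (le_bigmax_cond _ (fun P : {ffun 'I_m -> 'I_n} => _)).
Qed.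

Lemma ranked_setT (m : nat) (J : seq nat) :
  ranked [set: 'I_m] J = [set g : 'I_m | g.+1 \in J].
Proof.
apply/setP => g; rewrite !inE /=; congr (_ \in J).
have winj : injective (widen_ord (ltn_ord g)) by move=> a b /(congr1 val) /= /val_inj.
rewrite -[RHS](card_ord g.+1) -(card_imset _ winj).
apply: eq_card => h; rewrite !inE; apply/idP/imsetP => [hg|[h' _ ->] /=].
  by exists (Ordinal (hg : (h < g.+1)%N)) => //; exact: val_inj.
by rewrite -ltnS.
Qed.

(** Ranks that no good attains, or that [J] repeats, add to the right side only. The predecessor
    appears because ranks start at 1 and goods at 0. *)
Lemma sum_ranked_le (m : nat) (J : seq nat) (wt : nat -> nat) :
  (\sum_(g in ranked [set: 'I_m] J) wt g <= \sum_(j <- J) wt j.-1)%N.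
Proof.
rewrite ranked_setT; under eq_bigl => g do rewrite inE.
elim: J => [|j J IH]; first by rewrite big_pred0.
rewrite big_cons; apply: leq_trans (leq_add (leqnn _) IH).
rewrite (bigID (fun g : 'I_m => g.+1 == j)) /=; apply: leq_add; last first.
  rewrite [leqRHS]big_mkcond [leqLHS]big_mkcond; apply: leq_sum => g _.
  by rewrite inE; case: eqP => //=; case: (_ \in J).
have [/andP[j0 jm]|jm] := boolP (0 < j <= m)%N.
  rewrite -(prednK j0) in jm *; rewrite (big_pred1 (Ordinal jm)) //= => g /=.
  by rewrite inE eqSS -val_eqE /= orbC andbC; case: (_ == _); rewrite ?orbT.
rewrite big_pred0 // => g; apply/negbTE; apply: contra jm => /andP[_ /eqP<-] /=.
exact: ltn_ord.
Qed.

(** Once [P0] has placed the first [p] goods, part [k] lacks [e * d k], which [d k] of the remaining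
    equal goods supply. To normalize an instance it is thus enough to place its large goods. *)
Lemma normalized_fill (R : realType) (n p e U : nat) (W : nat -> nat)
    (P0 : 'I_p -> 'I_n) (d : 'I_n -> nat) :
  (0 < n)%N -> (0 < U)%N ->
  (forall k, (\sum_(q < p | P0 q == k) W q + e * d k = U)%N) ->
  normalized n (@weight_val R (p + \sum_k d k) U
                  (fun q => if (q < p)%N then W q else e)).
Proof.
move=> n0 U0 WU; pose k0 := Ordinal n0.
(* Entry [r] of [s] is the part that receives the fill good number [r]. *)
pose s := flatten [seq nseq (d k) k | k <- enum 'I_n].
have size_s : size s = (\sum_k d k)%N.
  rewrite size_flatten /shape -map_comp sumnE big_map enumT.
  by apply: eq_bigr => k _ /=; rewrite size_nseq.
have count_s k : count_mem k s = d k.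
  rewrite count_flatten -map_comp sumnE big_map enumT.
  rewrite (bigD1 k) //= count_nseq /= eqxx mul1n big1 ?addn0 // => l lk.
  by rewrite count_nseq /= (negPf lk).
exists [ffun g => match split g with inl q => P0 q | inr r => nth k0 s r end] => k.
rewrite /weight_val /bundle (_ : (\sum_(g in _) _)%N = U) ?divff ?pnatr_eq0 -?lt0n //.
under eq_bigl => g do rewrite inE ffunE.
rewrite -[RHS](WU k) big_split_ord /=; congr (_ + _)%N.
  apply: eq_big => q; first by rewrite (unsplitK (inl _ q)).
  by rewrite ltn_ord.
under eq_bigl => r do rewrite (unsplitK (inr _ r)).
under eq_bigr => r do rewrite ltnNge leq_addr /=.
rewrite sum_nat_const mulnC -count_s -sum1_count -[s in RHS](mkseq_nth k0) size_s.
congr (_ * _)%N; rewrite big_map -[X in iota 0 X]subn0 -/(index_iota _ _) big_mkord.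
by rewrite -sum1_card; apply: eq_bigl => r; rewrite inE.
Qed.

(** * Refuting the guarantee by instances with [2 * n] large goods and a fill of equal goods *)

Lemma not_oblivious (R : realType) (n : nat) (T : 'I_n -> R) (rule : tie_rule R n)
    (i : 'I_n) (m : nat) (v : {set 'I_m} -> R) (ans : answers R n m) :
  (forall j, 0 < T j) -> additive_valuation v -> ordered v -> normalized n v ->
  (forall st j S, 0 <= ans st j S) -> (forall st S, ans st i S = v S) ->
  v (RBF T rule ans i) < T i -> ~ oblivious_T_MMS T rule.
Proof.
move=> T0 vadd vord vnorm ans0 ansi vi /(_ i m v ans vadd vord vnorm ans0 ansi).
rewrite leNgt => /negP; apply; apply: lt_le_trans vi _.
rewrite -[leLHS]mulr1 ler_pM2l ?T0 //; apply: MMS_ge1 => //.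
exact: leq_ltn_trans (ltn_ord i).
Qed.

(** The initial bags consist of exactly the [2 * n] large goods, so that bag filling adds only goods
    worth [e]. Three strict inequalities keep the four reduction sets below the threshold, since the
    bound for the first good together with a fill good also covers the first good alone. *)
Lemma fill_not_oblivious (R : realType) (n : nat) (T : 'I_n -> R)
    (rule : tie_rule R n) (i : 'I_n) (W : nat -> nat) (P0 : 'I_(2 * n) -> 'I_n)
    (d : 'I_n -> nat) (e U : nat) (accept : 'I_n -> R -> bool) :
  let m := (2 * n + \sum_k d k)%N in
  let wt q := if (q < 2 * n)%N then W q else e in
  let v := @weight_val R m U wt in
  forall inv : {set 'I_n} -> {set 'I_m} -> {ffun 'I_n -> {set 'I_m}} ->
    {set 'I_n} -> Prop,
  proper_rule rule -> (forall j, T j <= 1) -> (forall j, 0 < T j) -> (0 < U)%N ->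
  {in [pred q | q < 2 * n]%N &, {homo W : p q / (p <= q)%N >-> (q <= p)%N}} ->
  (forall q, (q < 2 * n)%N -> (e <= W q)%N) ->
  (forall k, \sum_(q < 2 * n | P0 q == k) W q + e * d k = U)%N ->
  (W 0 + e)%N%:R < T i * U%:R -> (W n.-1 + W n)%N%:R < T i * U%:R ->
  (W (2 * n - 2) + W (2 * n - 1) + e)%N%:R < T i * U%:R ->
  (forall (B : {ffun 'I_n -> {set 'I_m}}) (M : {set 'I_m}),
    (forall k : 'I_n, v (B k) = (W k + W (2 * n - k.+1))%N%:R / U%:R) ->
    (forall g : 'I_m, (g \in M) = (2 * n <= g)%N) ->
    inv [set: 'I_n] M B [set: 'I_n]) ->
  (forall N M B K k, inv N M B K -> k \in K -> T i <= v (B k) ->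
    exists j, [/\ j \in N, (j < i)%N & accept j (v (B k))]) ->
  (forall N M B K j k, inv N M B K -> j \in N -> j != i -> k \in K ->
    accept j (v (B k)) -> inv (N :\ j) M B (K :\ k)) ->
  (forall (N : {set 'I_n}) M B K g k, inv N M B K -> i \in N -> #|K| = #|N| ->
    (forall l, l \in K -> v (B l) < T i) ->
    (forall j l, j \in N -> j != i -> l \in K -> ~~ accept j (v (B l))) ->
    g \in M -> k \in K ->
    inv N (M :\ g) [ffun l => if l == k then g |: B k else B l] K) ->
  ~ oblivious_T_MMS T rule.
Proof.
move=> m wt v inv rP T1 T0 U0 Wle We WU S4 S2 S3 inv0 inv_hi inv_assign inv_fill.
have n0 : (0 < n)%N by exact: leq_ltn_trans (ltn_ord i).
have UR : 0 < U%:R :> R by rewrite ltr0n.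
have wt_le p q : (p <= q)%N -> (wt q <= wt p)%N.
  move=> pq; rewrite /wt; case: ltnP => q2; last by case: ltnP => // p2; exact: We.
  by rewrite (leq_ltn_trans pq q2) Wle // inE ?(leq_ltn_trans pq q2).
have vlt J : (\sum_(j <- J) wt j.-1)%:R < T i * U%:R :> R -> v (ranked [set: 'I_m] J) < T i.
  move=> Jlt; rewrite ltr_pdivrMr //; apply: le_lt_trans Jlt.
  by rewrite ler_nat; exact: sum_ranked_le.
apply: (@not_oblivious _ _ _ _ i m v (stubborn_answers i v accept)) => //.
- exact: weight_val_additive.
- by move=> g h gh; rewrite /v !weight_val1 ler_pM2r ?invr_gt0 // ler_nat wt_le.
- exact: normalized_fill.
- move=> st j S; rewrite /stubborn_answers; case: ifP => _; first exact: weight_val_ge0.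
  by case: (stage st).
- by move=> st S; rewrite /stubborn_answers eqxx.
apply: (@RBF_safe _ _ _ _ _ _ _ _ inv) => //.
- move=> X; rewrite !inE cardsT card_ord => /or4P[] /eqP->; apply: vlt;
    rewrite !big_cons big_nil addn0.
  + by apply: le_lt_trans S4; rewrite ler_nat /wt /= muln_gt0 n0 leq_addr.
  + apply: le_lt_trans S2; rewrite ler_nat /wt addn1 /=.
    by rewrite !ifT //; lia.
  + apply: le_lt_trans S3; rewrite ler_nat addn1 -subn1 -subnDA -[(2 * n).-1]subn1 /=.
    by rewrite /wt ltnn !ltn_subrL muln_gt0 n0 !addnA.
  + by apply: le_lt_trans S4; rewrite ler_nat /wt addn1 /= ltnn muln_gt0 n0.
have BE (k : 'I_n) : exists a b : 'I_m, [/\ val a = k, val b = (2 * n - k.+1)%N &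
    ranked [set: 'I_m] [:: k.+1; (2 * n + 1 - k.+1)%N] = [set a; b]].
  have kn := ltn_ord k.
  have am : (k < m)%N by rewrite /m; lia.
  have bm : (2 * n - k.+1 < m)%N by rewrite /m; lia.
  exists (Ordinal am), (Ordinal bm); split=> //.
  by apply/setP => g; rewrite ranked_setT !inE -!val_eqE /=; lia.
apply: inv0 => [k|g].
  rewrite ffunE; have [a [b [aE bE ->]]] := BE k; have kn := ltn_ord k.
  rewrite /v /weight_val big_setU1 ?big_set1 /=; last first.
    by rewrite inE -val_eqE /= aE bE; lia.
  by rewrite /wt aE bE !ifT //; lia.
rewrite inE leqNgt; congr (~~ _); apply/bigcupP/idP => [[k _]|g2].
  rewrite ffunE; have [a [b [aE bE ->]]] := BE k; have kn := ltn_ord k.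
  by rewrite !inE => /orP[] /eqP->; rewrite /= ?aE ?bE; lia.
(* This is the index of the bag that contains the large good [g], whichever half of the order it
   comes from. *)
have kn : (minn g (2 * n - g.+1) < n)%N by lia.
exists (Ordinal kn) => //; rewrite ffunE ranked_setT !inE /=; lia.
Qed.

(** * Counting over ordinals, and the estimate of a threshold by a ratio *)

Lemma sum_pairs (n : nat) (F : nat -> nat) :
  (\sum_(q < 2 * n) F q = \sum_(q < n) F (2 * q) + \sum_(q < n) F (2 * q).+1)%N.
Proof.
elim: n => [|n IH]; first by rewrite !big_ord0.
by rewrite mulnS add2n 2!big_ord_recr IH [in RHS]big_ord_recr [in RHS]big_ord_recr /=; lia.
Qed.

Lemma sum_pred1_ord (n q0 : nat) (p : pred nat) (F : nat -> nat) :
  (q0 < n)%N -> (forall q, (q < n)%N -> p q = (q == q0)) ->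
  (\sum_(q < n | p q) F q = F q0)%N.
Proof.
move=> q0n pE; rewrite (big_pred1 (Ordinal q0n)) // => q /=.
by rewrite pE // -val_eqE.
Qed.

Lemma card_ord_lt (n i : nat) : (i <= n)%N -> #|[set k : 'I_n | (k < i)%N]| = i.
Proof.
move=> i_n; rewrite -sum1_card -[RHS](card_ord i) -sum1_card (big_ord_widen n (fun=> 1%N)) //.
by apply: eq_bigl => k; rewrite inE.
Qed.

Lemma card_rshift (n p : nat) : #|[set g : 'I_(n + p) | (n <= g)%N]| = p.
Proof.
rewrite -sum1_card big_split_ord /= big_pred0 => [|g]; last by rewrite inE /= leqNgt ltn_ord.
rewrite add0n -[RHS](card_ord p) -sum1_card.
by apply: eq_bigl => g; rewrite inE /= leq_addr.
Qed.

Lemma card_setD1_with (T : finType) (A : {set T}) (p : pred T) x :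
  x \in A -> p x -> #|[set y in A | p y]| = #|[set y in A :\ x | p y]|.+1.
Proof.
move=> xA px; rewrite (cardsD1 x) inE xA px; congr _.+1.
by apply: eq_card => y; rewrite !inE andbA.
Qed.

(* Scaled by [U], the goods are two copies of [n + k] for each [k < n] and [i]
   goods worth [n].  Part [k] combines one copy of [n + k] and the second copy
   of [n + k'], where [k'] is [i - 1 - k] modulo [n], with a good worth [n] when
   [k < i].  All bags are worth [3n - 1], and one more good worth [n] makes a
   bag that an agent of higher priority takes. *)
Lemma threshold_le_ratio (R : realType) (n : nat) (T : 'I_n -> R)
    (rule : tie_rule R n) (i : 'I_n) :
  proper_rule rule -> (forall j, T j <= 1) -> (forall j, 0 < T j) ->
  oblivious_T_MMS T rule -> T i <= 3 * n%:R / (3 * n%:R + i%:R - 1).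
Proof.
move=> rP T1 T0 obl; rewrite leNgt; apply/negP => Ti.
have i_n := ltn_ord i; pose U := (3 * n + i - 1)%N.
have UE : 3 * n%:R + i%:R - 1 = U%:R :> R.
  by rewrite /U natrB; [rewrite natrD natrM|lia].
have U0 : (0 < U)%N by rewrite /U; lia.
have nT : (3 * n)%:R < T i * U%:R.
  by rewrite -ltr_pdivrMr ?ltr0n // natrM -UE.
have ltT k : (k <= 3 * n)%N -> k%:R < T i * U%:R.
  by move=> kn; apply: le_lt_trans nT; rewrite ler_nat.
(* Positions [q] with [n - 1 - q./2 = k] hold the two copies of [n + k]. The map from [k] to [k'] is
   an involution, so [lbl] can send the second (odd) copy of [n + k] to part [k']. *)
pose W q := (2 * n - 1 - q./2)%N.
pose lbl (q : nat) : nat := (if odd q then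
    if n - 1 - q./2 < i then i - 1 - (n - 1 - q./2) else n + i - 1 - (n - 1 - q./2)
  else n - 1 - q./2)%N.
pose P0 (q : 'I_(2 * n)) : 'I_n := insubd i (lbl q).
pose d (k : 'I_n) : nat := (k < i)%N.
have WU k : (\sum_(q < 2 * n | P0 q == k) W q + n * d k = U)%N.
  have kn := ltn_ord k.
  rewrite (eq_bigl (fun q : 'I_(2 * n) => lbl q == k)); last first.
    move=> q; rewrite -val_eqE /P0 val_insubd ifT //.
    by have := ltn_ord q; rewrite /lbl; case: ifP; [case: ifP|]; lia.
  rewrite big_mkcond (sum_pairs n (fun q => if lbl q == k then W q else 0%N)) -!big_mkcond /=.
  rewrite (@sum_pred1_ord n (n - 1 - k) (fun q => lbl (2 * q) == k) (fun q => W (2 * q))%N).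
  - pose k' := (if k < i then i - 1 - k else n + i - 1 - k)%N.
    rewrite (@sum_pred1_ord n (n - 1 - k') (fun q => lbl (2 * q).+1 == k) (fun q => W (2 * q).+1)%N).
    + by rewrite /W /d /U /k'; case: ifP; lia.
    + by rewrite /k'; lia.
    + by move=> q qn; rewrite /lbl /k' ifT; [case: ifP; case: ifP|]; lia.
  - by lia.
  - by move=> q qn; rewrite /lbl ifF; lia.
have WUe : forall p q : nat, (p <= q)%N -> (W q <= W p)%N by move=> p q pq; rewrite /W; lia.
have sum_d : (\sum_k d k = i)%N.
  rewrite -[RHS](card_ord_lt (ltnW i_n)) -sum1_card [RHS]big_mkcond.
  by apply: eq_bigr => k _; rewrite /d inE; case: ltnP.
pose v := @weight_val R (2 * n + \sum_k d k) U (fun q => if (q < 2 * n)%N then W q else n).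
(* A fill good lifts at most one bag to the threshold, and each lifted bag is taken by one agent of
   higher priority. At the start there are [i] fill goods and [i] such agents. *)
apply: (@fill_not_oblivious R n T rule i W P0 d n U
  (fun j x => (j < i)%N && (T i <= x))
  (fun N M B K => #|[set k in K | (T i <= v (B k))%R]| + #|M|
     <= #|[set j in N | (j < i)%N]|)%N) obl; rewrite -/v => //.
- by move=> p q _ _ pq; rewrite /W; lia.
- by move=> q qn; rewrite /W; lia.
- by rewrite ltT // /W; lia.
- by rewrite ltT // /W; lia.
(* The last two large goods and a fill good are worth exactly [3 * n], the numerator of the
   bound. *)
- by rewrite ltT // /W; lia.
- move=> B M vB ME.
  rewrite (_ : [set k in _ | _] = set0) ?cards0; last first.
    apply/setP => k; rewrite !inE leNgt vB ltr_pdivrMr ?ltr0n // ltT //.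
    by have := ltn_ord k; rewrite /W; lia.
  rewrite add0n (_ : M = [set g : 'I_(2 * n + _) | (2 * n <= g)%N]); last first.
    by apply/setP => g; rewrite ME inE.
  rewrite card_rshift sum_d -[leqLHS](card_ord_lt (ltnW i_n)) subset_leq_card //.
  by apply/subsetP => k; rewrite !inE.
- move=> N M B K k inv kK vk.
  have /card_gt0P[j] : (0 < #|[set j in N | (j < i)%N]|)%N.
    apply: leq_trans inv; rewrite ltn_addr //.
    by apply/card_gt0P; exists k; rewrite inE kK.
  by rewrite inE => /andP[jN ji]; exists j; rewrite jN ji vk.
- move=> N M B K j k inv jN ji kK /andP[j_i vk].
  by rewrite (card_setD1_with (p := fun k => (T i <= v (B k))%R) kK vk)
     (card_setD1_with jN j_i) addSn ltnS in inv.
- move=> N M B K g k inv iN cK vlt _ gM kK; apply: leq_trans inv.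
  rewrite (cardsD1 g M) gM [leqRHS]addnA leq_add2r.
  apply: leq_trans (leq_addl _ _); rewrite (leq_trans (subset_leq_card _) (_ : #|[set k]| <= 1)%N) ?cards1 //.
  apply/subsetP => l; rewrite !inE ffunE => /andP[lK].
  by case: eqP => // _; rewrite leNgt vlt.
Qed.

(** * The linear estimate of a threshold in the first half of the ranks *)

Lemma card_le_window (n s l : nat) (A : {set 'I_n}) :
  (forall q, q \in A -> s <= q < s + l)%N -> (#|A| <= l)%N.
Proof.
move=> As; rewrite cardE -(size_map val) -[leqRHS](size_iota s).
apply: uniq_leq_size => [|_ /mapP[q qA ->]]; last by rewrite mem_iota As // -mem_enum.
by rewrite map_inj_uniq ?enum_uniq //; exact: val_inj.
Qed.

Lemma sum_const_set (I : finType) (p : pred I) (c : nat) :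
  (\sum_(x | p x) c = #|[set x | p x]| * c)%N.
Proof. by rewrite -sum_nat_const; apply: eq_bigl => x; rewrite inE. Qed.

(* Scaled by [U], the goods are [i] goods worth [K * (3 * n - i)], then
   [2 * n - i] goods worth [K * n], a third of a part, and a fill of goods worth
   [1].  Part [k < i] is one good of the first kind and fill; all other parts have
   at most three goods of the second kind.  Each agent of higher priority takes a
   bag with one good of each kind.  The other [n - i] bags and the fill are worth
   [(n - i) * (K * (3 * n - i))], so that [K * (3 * n - i)] is left for agent [i]
   if each agent of lower priority takes a bag as soon as it is worth as much. *)
Lemma threshold_le_linear (R : realType) (n : nat) (T : 'I_n -> R)
    (rule : tie_rule R n) (i : 'I_n) :
  proper_rule rule -> (forall j, T j <= 1) -> (forall j, 0 < T j) ->
  oblivious_T_MMS T rule -> (2 * i <= n)%N -> T i <= 1 - i%:R / (3 * n%:R).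
Proof.
move=> rP T1 T0 obl i2n; rewrite leNgt; apply/negP => Ti.
have i_n := ltn_ord i; have n0 : (0 < n)%N by lia.
have nR : 0 < n%:R :> R by rewrite ltr0n.
pose a := (3 * n - i)%N.
have aE : a%:R = 3 * n%:R - i%:R :> R by rewrite /a natrB ?natrM //; lia.
have gap : 0 < T i * (3 * n%:R) - a%:R.
  have : (1 - i%:R / (3 * n%:R)) * (3 * n%:R) < T i * (3 * n%:R) by rewrite ltr_pM2r // mulr_gt0.
  by rewrite mulrBl divfK ?mul1r ?aE ?subr_gt0 // mulf_neq0 ?pnatr_eq0 //; lia.
(* [K] is so large that goods worth [1] fit between [c] and the threshold. *)
have [K Kgap] : exists K, 1 < K%:R * (T i * (3 * n%:R) - a%:R).
  exists (Num.bound (T i * (3 * n%:R) - a%:R)^-1).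
  by rewrite -ltr_pdivrMr // mul1r; apply: archi_boundP; rewrite invr_ge0 ltW.
have K0 : (0 < K)%N.
  by rewrite lt0n; apply: contraTneq Kgap => ->; rewrite mul0r ltr10.
pose U := (3 * n * K)%N.
have U0 : (0 < U)%N by rewrite /U !muln_gt0 n0 K0.
have UR : 0 < U%:R :> R by rewrite ltr0n.
have KaT : (K * a + 1)%N%:R < T i * U%:R.
  by rewrite natrD /U !natrM; nra.
have ltT k : (k <= K * a + 1)%N -> k%:R < T i * U%:R.
  by move=> kn; apply: le_lt_trans KaT; rewrite ler_nat.
have Kn0 : (0 < K * n)%N by rewrite muln_gt0 K0.
have Kna : (2 * (K * n) <= K * a)%N by rewrite mulnCA leq_mul2l /a; lia.
have UKa : (U <= K * a + K * n)%N.
  by rewrite /U -mulnDr [(_ * K)%N]mulnC leq_mul2l /a; lia.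
pose W (q : nat) : nat := (if q < i then K * a else K * n)%N.
have W_le p q : (p <= q)%N -> (W q <= W p)%N.
  move=> pq; rewrite /W; have [pi|ip] := ltnP p i; last by rewrite ltnNge (leq_trans ip pq).
  by case: ifP; lia.
have W_gt0 q : (0 < W q)%N by rewrite /W; case: ifP; lia.
have W0 : (W 0 <= K * a)%N by rewrite /W; case: ifP; lia.
have Wge q : (i <= q)%N -> W q = (K * n)%N by rewrite /W ltnNge => ->.
have W_mid : (W n.-1 + W n <= K * a)%N by rewrite !Wge; lia.
have W_last : (W (2 * n - 2) + W (2 * n - 1) <= K * a)%N by rewrite !Wge; lia.
have W_pair k : (k < n)%N -> W (2 * n - k.+1)%N = (K * n)%N by move=> kn; apply: Wge; lia.
(* The goods of the second kind go in threes to the parts from [i] on. These parts suffice because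
   [2 * i <= n] gives [2 * n - i <= 3 * (n - i)]. *)
pose lbl (q : nat) : nat := (if q < i then q else i + (q - i) %/ 3)%N.
pose P0 (q : 'I_(2 * n)) : 'I_n := insubd i (lbl q).
pose d (k : 'I_n) : nat := (U - \sum_(q < 2 * n | P0 q == k) W q)%N.
have P0E k (q : 'I_(2 * n)) : (P0 q == k) = (lbl q == k).
  rewrite -val_eqE /P0 val_insubd ifT //.
  by have := ltn_ord q; rewrite /lbl; case: ifP; lia.
have WU k : (\sum_(q < 2 * n | P0 q == k) W q + 1 * d k = U)%N.
  have kn := ltn_ord k; rewrite mul1n /d subnKC // (eq_bigl _ _ (P0E k)).
  have [ki|ik] := ltnP k i.
    rewrite (@sum_pred1_ord _ k (fun q => lbl q == k) W); [|lia|].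
      by rewrite /W ki /U /a; nia.
    by move=> q qn; rewrite /lbl; case: ifP; lia.
  apply: (@leq_trans (\sum_(q < 2 * n | lbl q == k) K * n)).
    by apply: leq_sum => q; rewrite /lbl /W; case: ifP => //; lia.
  rewrite sum_const_set /U.
  rewrite -mulnA [(n * K)%N]mulnC leq_mul2r; apply/orP; right.
  apply: (@card_le_window _ (i + 3 * (k - i))) => q; rewrite inE /lbl.
  by case: ifP; lia.
have sumW : (\sum_(q < 2 * n) W q = i * (K * a) + (2 * n - i) * (K * n))%N.
  rewrite (bigID (fun q : 'I_(2 * n) => (q < i)%N)) /=; congr (_ + _)%N.
    rewrite (eq_bigr (fun=> K * a)%N) => [|q qi]; last by rewrite /W qi.
    by rewrite sum_const_set card_ord_lt //; lia.
  rewrite (eq_bigr (fun=> K * n)%N) => [|q qi]; last by rewrite /W (negPf qi).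
  rewrite sum_const_set; congr (_ * _)%N.
  have i2 : (i <= 2 * n)%N by lia.
  rewrite -[X in (_ - X)%N](card_ord_lt i2) -[X in (X - _)%N](card_ord (2 * n)).
  by rewrite -(cardsC [set q : 'I_(2 * n) | (q < i)%N]) addKn; apply: eq_card => q; rewrite !inE.
have sum_d : (\sum_k d k = K * (n - i) * (n - i))%N.
  have : (\sum_k (\sum_(q < 2 * n | P0 q == k) W q + 1 * d k) = n * U)%N.
    by rewrite (eq_bigr _ (fun k _ => WU k)) sum_nat_const card_ord.
  rewrite big_split /= (_ : \sum_k \sum_(q < 2 * n | P0 q == k) W q = \sum_(q < 2 * n) W q)%N.
    2: by rewrite [RHS](partition_big P0 xpredT).
  rewrite sumW.
  under eq_bigr do rewrite mul1n.
  by rewrite /U /a; nia.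
(* An agent of lower priority takes a bag from the value [c] on. By [cT], one fill good cannot lift
   a bag from below [c] to the threshold. *)
pose c : R := (K * a)%N%:R / U%:R.
have cT : c + U%:R^-1 < T i.
  by rewrite /c -[X in _ + X]mul1r -mulrDl ltr_pdivrMr // -(natrD _ _ 1).
have Ui : 0 < U%:R^-1 :> R by rewrite invr_gt0.
pose v := @weight_val R (2 * n + \sum_k d k) U (fun q => if (q < 2 * n)%N then W q else 1%N).
(* Bags that reach the threshold count as 0, being reserved for agents of higher priority. *)
pose low (x : R) := if x < T i then x else 0.
have low_le x : 0 <= x -> low x <= x by rewrite /low; case: ifP.
have low_lt x : x < T i -> low x = x by rewrite /low => ->.
have low0 x : T i <= x -> low x = 0 by rewrite /low leNgt => /negPf ->.
(* The invariant says that there are enough agents of higher priority for the bags at the threshold,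
   and that the other bags and the fill are worth less than [c] for each agent of lower priority
   plus [T i]. *)
apply: (@fill_not_oblivious R n T rule i W P0 d 1 U
  (fun j x => if (j < i)%N then T i <= x else (c <= x) && (x < T i))
  (fun N M B K => [/\ (#|[set k in K | (T i <= v (B k))%R]| <=
      #|[set j in N | (j < i)%N]|)%N,
     \sum_(k in K) low (v (B k)) + v M < c * #|[set j in N | (i < j)%N]|%:R + T i &
     forall g, g \in M -> (2 * n <= g)%N])) obl; rewrite -/v => //.
- by move=> p q _ _; exact: W_le.
- by rewrite ltT // leq_add2r.
- by rewrite ltT // (leq_trans W_mid) ?leq_addr.
- by rewrite ltT // leq_add2r.
- move=> B M vB ME.
  have vM : v M = (K * (n - i) * (n - i))%N%:R / U%:R.
    rewrite /v /weight_val (_ : \sum_(g in M) _ = K * (n - i) * (n - i))%N //.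
    rewrite (eq_bigr (fun=> 1%N)) => [|g]; last by rewrite ME ltnNge => ->.
    rewrite sum1_card -sum_d -[RHS](card_rshift (2 * n)).
    by apply: eq_card => g; rewrite inE ME.
  have big_bag (k : 'I_n) : (k < i)%N -> T i <= v (B k).
    move=> ki; apply: le_trans (T1 i) _; rewrite vB ler_pdivlMr // mul1r ler_nat.
    by rewrite W_pair // /W ki.
  have small_bag (k : 'I_n) : ~~ (k < i)%N -> v (B k) = (2 * K * n)%N%:R / U%:R.
    have kn := ltn_ord k; rewrite -leqNgt => ik.
    by rewrite vB W_pair // Wge // addnn -mulnA mul2n.
  split=> [||g]; last by rewrite ME.
    apply: subset_leq_card; apply/subsetP => k; rewrite !inE /=.
    apply: contraTT => ki; rewrite -ltNge small_bag // ltr_pdivrMr // ltT //.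
    by rewrite -mulnA (leq_trans Kna) ?leq_addr.
  have -> : #|[set j in [set: 'I_n] | (i < j)%N]| = (n - i.+1)%N.
    rewrite -[X in (_ - X)%N](card_ord_lt i_n) -[X in (X - _)%N](card_ord n).
    rewrite -(cardsC [set j : 'I_n | (j < i.+1)%N]) addKn.
    by apply: eq_card => j; rewrite !inE -ltnNge.
  have -> : \sum_(k in [set: 'I_n]) low (v (B k)) = (n - i)%N%:R * ((2 * K * n)%N%:R / U%:R).
    rewrite (bigID (fun k : 'I_n => (k < i)%N)) /= big1 => [|k /andP[_ ki]]; last first.
      by rewrite low0 ?big_bag.
    rewrite add0r (eq_bigr (fun=> (2 * K * n)%N%:R / U%:R)) => [|k /andP[_ ki]]; last first.
      rewrite small_bag // low_lt // ltr_pdivrMr // ltT //.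
      by rewrite -mulnA (leq_trans Kna) ?leq_addr.
    rewrite sumr_const [RHS]mulr_natl; congr (_ *+ _).
    rewrite -[X in (_ - X)%N](card_ord_lt (ltnW i_n)) -[X in (X - _)%N](card_ord n).
    rewrite -(cardsC [set j : 'I_n | (j < i)%N]) addKn.
    by apply: eq_card => j; rewrite [LHS]unfold_in !inE.
  rewrite vM mulrA -mulrDl -natrM -natrD.
  (* The value is exactly [c] for each agent of lower priority plus one more [c]; strictness comes
     from [c < T i]. *)
  rewrite (_ : (n - i) * (2 * K * n) + _ = K * a * (n - i.+1) + K * a)%N.
    by rewrite natrD natrM mulrDl mulrAC ltrD2l -/c; lra.
  rewrite [RHS]addnC -mulnS subnSK // (_ : a = 2 * n + (n - i))%N; last by rewrite /a; lia.
  by move: (n - i)%N => x; ring.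
- move=> N M B K' k [inv _ _] kK vk.
  have /card_gt0P[j] : (0 < #|[set j in N | (j < i)%N]|)%N.
    by apply: leq_trans inv; apply/card_gt0P; exists k; rewrite inE kK.
  by rewrite inE => /andP[jN ji]; exists j; rewrite jN ji vk.
- move=> N M B K' j k [inv1 inv2 inv3] jN ji kK; case: ifP => [j_i vk|ij /andP[cv vT]].
    split=> //.
      by rewrite (card_setD1_with (p := fun k => (T i <= v (B k))%R) kK vk)
        (card_setD1_with jN j_i) ltnS in inv1.
    rewrite (big_setD1 k) //= low0 // add0r in inv2; apply: lt_le_trans inv2 _.
    rewrite lerD2r ler_wpM2l ?divr_ge0 // ler_nat subset_leq_card //.
    apply/subsetP => j'; rewrite !inE => /andP[-> ij']; rewrite ij' !andbT.
    by apply: contraTneq ij' => ->; rewrite -leqNgt ltnW.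
  have i_j : (i < j)%N by rewrite ltn_neqAle eq_sym ji leqNgt ij.
  split=> //.
    apply: leq_trans (leq_trans inv1 _).
      apply: subset_leq_card; apply/subsetP => k'; rewrite !inE.
      by case/andP=> /andP[_ ->] ->.
    apply: subset_leq_card; apply/subsetP => j'; rewrite !inE => /andP[-> j'i].
    by rewrite j'i !andbT; apply: contraTneq j'i => ->; rewrite ij.
  rewrite (big_setD1 k) //= low_lt // (card_setD1_with jN i_j) in inv2.
  by move: inv2; rewrite -natr1; lra.
- move=> N M B K' g k [inv1 inv2 inv3] iN cK vlt noacc gM kK.
  have vg : v [set g] = U%:R^-1 by rewrite /v weight_val1 ltnNge inv3 //= mul1r.
  have vU : v (g |: B k) <= U%:R^-1 + v (B k).
    by rewrite -vg /v weight_val1; exact: weight_valU1_le.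
  have vM : v M = U%:R^-1 + v (M :\ g).
    by rewrite -vg /v weight_val1; exact: weight_valD1.
  have v0 S : 0 <= v S by exact: weight_val_ge0.
  (* Suppose no agent of higher priority is left. If one of lower priority is, she has refused the
     bag, which is thus below [c] and one fill good short of the threshold at best. Otherwise the
     invariant bounds the bag and the fill together by [T i]. *)
  have cross : T i <= v (g |: B k) -> (0 < #|[set j in N | (j < i)%N]|)%N.
    move=> vT; rewrite lt0n; apply: contraTneq vT => /eqP.
    rewrite cards_eq0 => /eqP hi0; rewrite -ltNge.
    have [lo0|/set0Pn[j]] := eqVneq [set j in N | (i < j)%N] set0; last first.
      rewrite inE => /andP[jN ij]; apply: le_lt_trans vU _.
      have := noacc j k jN _ kK; rewrite ltnNge (ltnW ij) /= vlt // andbT -ltNge.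
      by rewrite neq_ltn ij orbT => /(_ isT); move: cT; lra.
    have N1 : N = [set i].
      apply/setP => j; rewrite inE; apply/idP/eqP => [jN|-> //].
      have := in_set0 j; rewrite -{1}hi0 inE jN /= => /negbT ji.
      have := in_set0 j; rewrite -{1}lo0 inE jN /= => /negbT ij.
      by apply/val_inj/eqP; rewrite eqn_leq leqNgt ij leqNgt ji.
    move: inv2; rewrite (big_setD1 k) //= low_lt ?vlt // lo0 cards0 mulr0 add0r.
    have : 0 <= \sum_(l in K' :\ k) low (v (B l)).
      by apply: sumr_ge0 => l _; rewrite /low; case: ifP.
    by move: vU (v0 (M :\ g)); rewrite vM; lra.
  split=> [||h]; last by rewrite inE => /andP[_]; exact: inv3.
    have sub : [set l in K' | (T i <= v ([ffun l => if l == k then g |: B k else B l] l))%R] \subset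
        (if (T i <= v (g |: B k))%R then [set k] else set0).
      apply/subsetP => l; rewrite inE ffunE => /andP[lK].
      by case: eqP => [-> ->|_]; rewrite ?inE // leNgt vlt.
    by apply: leq_trans (subset_leq_card sub) _; case: ifP => [/cross|_]; rewrite ?cards1 ?cards0.
  apply: le_lt_trans inv2; rewrite (big_setD1 k) //= [X in _ <= X + _](big_setD1 k) //=.
  rewrite ffunE eqxx vM (low_lt (v (B k))) ?vlt //.
  rewrite (eq_bigr (fun l => low (v (B l)))) => [|l]; last by rewrite !inE ffunE => /andP[/negPf->].
  have : low (v (g |: B k)) <= U%:R^-1 + v (B k).
    exact: le_trans (low_le _ (v0 _)) vU.
  by lra.
Qed.

(** * Summing the estimates *)

Lemma ln_sub_ge (R : realType) (x : R) : 1 < x -> x^-1 <= ln x - ln (x - 1).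
Proof.
move=> x1; have x0 : 0 < x by lra.
(* The claim becomes [ln (1 + y) <= y] at [y = - x^-1]. *)
rewrite -lerN2 opprB -ln_div ?posrE ?subr_gt0 // mulrBl divff ?gt_eqF // mul1r.
by rewrite -[1 - _]/(1 + - _); apply: le_ln1Dx; rewrite ltrN2 invf_lt1.
Qed.

Lemma sum_inv_le_ln (R : realType) (x : R) (b n : nat) : 1 < x + b%:R -> (b <= n)%N ->
  \sum_(b <= h < n) (x + h%:R)^-1 <= ln (x + n%:R - 1) - ln (x + b%:R - 1).
Proof.
move=> xb bn.
rewrite -(telescope_sumr (fun h => ln (x + h%:R - 1)) bn) !big_nat.
apply: ler_sum => h /andP[bh _].
have -> : x + h.+1%:R - 1 = x + h%:R by rewrite -natr1; lra.
apply: ln_sub_ge; apply: lt_le_trans xb _; by rewrite lerD2l ler_nat.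
Qed.

Lemma sum_linear (R : realFieldType) (a n : nat) : (0 < n)%N ->
  \sum_(0 <= h < a.+1) (1 - h%:R / (3 * n%:R)) =
  a%:R + 1 - a%:R * (a%:R + 1) / (6 * n%:R) :> R.
Proof.
move=> n0; have nR : n%:R != 0 :> R by rewrite pnatr_eq0 -lt0n.
elim: a => [|a IH]; first by rewrite big_nat1; field.
by rewrite big_nat_recr //= IH -natr1; field.
Qed.

Lemma sum_threshold_le (R : realType) (n : nat) (T : 'I_n -> R) :
  (0 < n)%N -> (forall i j : 'I_n, (i <= j)%N -> T j <= T i) ->
  (forall i : 'I_n, (2 * i <= n)%N -> T i <= 1 - i%:R / (3 * n%:R)) ->
  (forall i : 'I_n, T i <= 3 * n%:R / (3 * n%:R + i%:R - 1)) ->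
  \sum_(i < n) T i <= n%:R * (13 / 24 + 3 * ln (10 / 9)) + 1 / 3.
Proof.
move=> n0 Tmono Tlin Tratio; pose a := n./2.
have nR : 1 <= n%:R :> R by rewrite ler1n.
have split_sum b : (a < b <= n)%N -> \sum_(i < n) T i <=
    (a%:R + 1 - a%:R * (a%:R + 1) / (6 * n%:R)) +
    (b%:R - a%:R - 1) * (1 - a%:R / (3 * n%:R)) +
    3 * n%:R * (ln (4 * n%:R - 2) - ln (3 * n%:R + b%:R - 2)).
  move=> /andP[ab bn].
  pose g h : R := if (h <= a)%N then 1 - h%:R / (3 * n%:R) else
    if (h < b)%N then 1 - a%:R / (3 * n%:R) else 3 * n%:R / (3 * n%:R - 1 + h%:R).
  have Tg i : T i <= g i.
    rewrite /g; have [ia|ia] := leqP i a; first by apply: Tlin; rewrite /a in ia; lia.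
    case: ltnP => ib; last by rewrite addrAC; exact: Tratio.
    have an : (a < n)%N by exact: leq_trans ab bn.
    apply: le_trans (Tmono (Ordinal an) i (ltnW ia)) _.
    by apply: Tlin; rewrite /= /a; lia.
  apply: le_trans (ler_sum _ (fun i _ => Tg i)) _.
  rewrite -(big_mkord xpredT g) (@big_cat_nat _ _ _ a.+1) //= ?(leq_trans ab) //.
  rewrite (@big_cat_nat _ _ _ b a.+1) //= addrA; apply: lerD; first apply: lerD.
  - rewrite -sum_linear // le_eqVlt; apply/orP; left; apply/eqP.
    by apply: eq_big_nat => h /andP[_ ha]; rewrite /g -ltnS ha.
  - rewrite (eq_big_nat _ _ (F2 := fun=> 1 - a%:R / (3 * n%:R))) => [|h /andP[ah hb]].
      rewrite sumr_const_nat -[X in X <= _]mulr_natl.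
      by rewrite natrB // -natr1 opprD addrA.
    by rewrite /g hb leqNgt ah.
  - rewrite (eq_big_nat _ _ (F2 := fun h => 3 * n%:R * (3 * n%:R - 1 + h%:R)^-1)) => [|h /andP[bh hn]].
      rewrite -mulr_sumr; apply: ler_wpM2l; first by lra.
        have := @sum_inv_le_ln R (3 * n%:R - 1) b n _ bn.
        have -> : 3 * n%:R - 1 + n%:R - 1 = 4 * n%:R - 2 :> R by lra.
        have -> : 3 * n%:R - 1 + b%:R - 1 = 3 * n%:R + b%:R - 2 :> R by lra.
        apply; have : 0 <= b%:R :> R by [].
        by lra.
    by rewrite /g leqNgt (leq_trans ab bh) ltnNge bh.
have aE : 2 * a%:R = n%:R - (odd n)%:R :> R.
  by rewrite -[X in X%:R - _](odd_double_half n) natrD -mul2n natrM; lra.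
(* This is the tangent to the logarithm at [10 / 9], the limit of [(4 * n - 2) / (3 * n + b - 2)]
   when [b] is about [3 * n / 5]. *)
have ln_ratio (x y : R) : 0 < x -> 0 < y ->
    ln x - ln y <= ln (10 / 9) + (9 * x - 10 * y) / (10 * y).
  move=> x0 y0; have : ln (x / y / (10 / 9)) <= (9 * x - 10 * y) / (10 * y).
    rewrite (_ : x / y / (10 / 9) = 1 + (9 * x - 10 * y) / (10 * y)).
      apply: le_ln1Dx; rewrite -subr_gt0.
      rewrite (_ : _ - -1 = 9 * x / (10 * y)); last by field; rewrite gt_eqF.
      by rewrite divr_gt0 ?mulr_gt0.
    by field; rewrite gt_eqF.
  by rewrite !ln_div ?posrE ?divr_gt0 //; lra.
(* For [n <= 3] the choice [b = n] makes the logarithms cancel, and [ln (10 / 9) >= 1 / 10] is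
   enough. *)
have [n3|n4] := leqP n 3.
  have ln109 : 1 / 10 <= ln (10 / 9) :> R.
    by have := ln_ratio 1 1 ltr01 ltr01; lra.
  have := split_sum n; rewrite leqnn andbT => /(_ _)/le_trans; apply; first by rewrite /a; lia.
  rewrite (_ : 3 * n%:R + n%:R - 2 = 4 * n%:R - 2 :> R); last by lra.
  rewrite subrr mulr0 addr0 /a.
  by move: n3 n0; case: (n) => [|[|[|[|]]]] //= _ _; lra.
(* The two bounds used around [b] cross at [3 n / 5], where both are [5 / 6]. *)
pose b := ((3 * n + 4) %/ 5).+1.
have bn : (a < b <= n)%N by rewrite /a /b; lia.
apply: le_trans (split_sum b bn) _.
have n4R : 4 <= n%:R :> R by rewrite ler_nat.
have b_lo : 3 * n%:R + 5 <= 5 * b%:R :> R.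
  by rewrite -!natrM -natrD ler_nat /b; lia.
have b_hi : 5 * b%:R <= 3 * n%:R + 9 :> R.
  by rewrite -!natrM -natrD ler_nat /b; lia.
set L := ln (10 / 9); set D := 3 * n%:R + b%:R - 2 :> R.
have D0 : 0 < D by rewrite /D; lra.
have : 3 * n%:R * (ln (4 * n%:R - 2) - ln D) <=
    3 * n%:R * L + 3 * n%:R * (6 * n%:R - 10 * b%:R + 2) / (10 * D).
  rewrite -[X in _ <= _ + X]mulrA -mulrDr; apply: ler_wpM2l; first by lra.
  have := ln_ratio (4 * n%:R - 2) D _ D0; rewrite -/L.
  rewrite (_ : 9 * (4 * n%:R - 2) - 10 * D = 6 * n%:R - 10 * b%:R + 2); last by rewrite /D; lra.
  by apply; lra.
suff : a%:R + 1 - a%:R * (a%:R + 1) / (6 * n%:R) + (b%:R - a%:R - 1) * (1 - a%:R / (3 * n%:R)) +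
    3 * n%:R * (6 * n%:R - 10 * b%:R + 2) / (10 * D) <= n%:R * (13 / 24) + 1 / 3.
  by lra.
rewrite -lerBrDl ler_pdivrMr ?mulr_gt0 // /D.
move: n4R b_lo b_hi aE; move: (n%:R) (b%:R) (a%:R) => N B A n4R b_lo b_hi aE.
(* The variable [u] is the rounding in [b]. It lies between 0 and 1, so [u * (1 - u)] is
   nonnegative, which the final polynomial inequality uses. *)
have [u uE] : exists u, B = 3 / 5 * N + 2 - u by exists (3 / 5 * N + 2 - B); lra.
have u0 : 0 <= u by lra.
have u1 : u <= 1 by lra.
have N0 : N != 0 by rewrite gt_eqF //; lra.
have uu : 0 <= u * (1 - u) by nra.
(* For odd [n] the half is [(N - 1) / 2], and the terms in [N^-1] that it leaves are treated as a
   separate variable. *)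
case: (odd n) aE => /= aE.
  have -> : A = (N - 1) / 2 by lra.
  have I0 : 0 < N^-1 by rewrite invr_gt0; lra.
  have NI : N * N^-1 = 1 by rewrite divff.
  have -> : (N - 1) / 2 * ((N - 1) / 2 + 1) / (6 * N) = (N - N^-1) / 24 by field.
  have -> : (N - 1) / 2 / (3 * N) = (1 - N^-1) / 6 by field.
  have uI : 0 <= u * N^-1 by rewrite mulr_ge0 // ltW.
  have I1 : N^-1 <= 1 / 4 by nra.
  rewrite uE; move: (N^-1) I0 NI uI I1 => I I0 NI uI I1.
  nra.
have -> : A = N / 2 by lra.
have -> : N / 2 * (N / 2 + 1) / (6 * N) = (N / 2 + 1) / 12 by field.
have -> : N / 2 / (3 * N) = 1 / 6 by field.
by rewrite uE; nra.
Qed.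
Theorem theorem11 (R : realType) (n : nat) (n_gt0 : (0 < n)%N)
  (T : 'I_n -> R) (T_le1 : forall i, T i <= 1)
  (T_noninc : forall i j : 'I_n, (i <= j)%N -> T j <= T i)
  (T_gt0 : forall i, 0 < T i)
  (rule : tie_rule R n) (rule_proper : proper_rule rule)
  (T_MMS : oblivious_T_MMS T rule) :
  [/\ n%:R^-1 * (\sum_(i < n) T i)
        <= 13 / 24 + 3 * ln (10 / 9) + 1 / (3 * n%:R),
      T (last_agent n_gt0) <= 3 * n%:R / (4 * n%:R - 2)
    & 3 * n%:R / (4 * n%:R - 2) = 3 / 4 + 3 / (8 * n%:R - 4) :> R].
Proof.
have n1 : 1 <= n%:R :> R by rewrite ler1n.
have ratio i : T i <= 3 * n%:R / (3 * n%:R + i%:R - 1).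
  exact: threshold_le_ratio T_MMS.
split.
- rewrite mulrC ler_pdivrMr ?ltr0n // (le_trans (sum_threshold_le n_gt0 T_noninc _ ratio)) //.
    by move=> i; exact: threshold_le_linear T_MMS.
  rewrite le_eqVlt; apply/orP; left; apply/eqP; set L := ln _.
  by field; rewrite gt_eqF //; lra.
- apply: le_trans (ratio _) _; rewrite /= -subn1 natrB //.
  by rewrite (_ : 3 * n%:R + (n%:R - 1%:R) - 1 = 4 * n%:R - 2 :> R) //; lra.
- by field; rewrite !gt_eqF //; lra.
Qed.
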